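(* Let $X$ be a real Banach space, let $Z_1, Y$ be closed linear subspaces of $X$, and let $Z_2 = Z_1\cap Y$. Suppose that $Z_2$ is locally constrained with respect to $Z_1$ via $Y$. If $Z_1$ is a central subspace of $X$, then $Z_2$ is a central subspace of $Y$.
   Context: All Banach spaces are real; ''subspace'' means closed linear subspace; $B_X(x,r)$ denotes the closed ball in $X$ with center $x$ and radius $r>0$. Central subspace: a subspace $Y$ of a Banach space $X$ is a central subspace of $X$ if every finite family of closed balls with centers in $Y$ that has nonempty intersection in $X$ also intersects in $Y$; i.e. for all $y_1,\dots,y_n\in Y$ and $r_1,\dots,r_n>0$, $\bigcap_{i=1}^n B_X(y_i,r_i)\neq\emptyset$ implies $Y\cap\bigcap_{i=1}^n B_X(y_i,r_i)\neq\emptyset$. Locally constrained: for subspaces $Z_1,Y$ of $X$ and $Z_2=Z_1\cap Y$, $Z_2$ is locally constrained with respect to $Z_1$ via $Y$ if for every $z\in Z_1$ there are linear projections $P:\operatorname{span}\{z,Z_2\}\to Z_2$ (onto $Z_2$) and $Q:\operatorname{span}\{z,Y\}\to Y$ (onto $Y$) of norm one such that $Pz=Qz$. *)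

(* Defs.v *)
From HB Require Import structures.
From mathcomp Require Import all_boot all_order all_algebra.
From mathcomp Require Import all_classical all_reals all_analysis.
Set Implicit Arguments.
Unset Strict Implicit.
Unset Printing Implicit Defensive.
Import Order.TTheory GRing.Theory Num.Theory.
Import numFieldNormedType.Exports.
Local Open Scope classical_set_scope.
Local Open Scope ring_scope.

Section Definitions.
Context {R : realType} {X : completeNormedModType R}.
Implicit Types (D S W Y Z : set X) (P Q : X -> X).

Definition linear_subspace S : Prop := GRing.submod_closed [in S].

Definition closed_subspace S : Prop := linear_subspace S /\ closed S.

Definition linear_span S : set X := smallest linear_subspace S.

(* Maps defined on a subspace D are represented by functions on X of which
   only the values on D matter. *)
Definition linear_on D P : Prop :=
  forall a, {in D &, forall u v, P (a *: u + v) = a *: P u + P v}.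

Definition opnorm_on D P : \bar R :=
  ereal_sup [set `|P x|%:E | x in D `&` [set x | `|x| <= 1]].

Definition projection_onto D Z P : Prop :=
  [/\ linear_on D P, P @` D = Z & {in D, forall x, P (P x) = P x}].

Definition norm_one_projection D Z P : Prop :=
  projection_onto D Z P /\ opnorm_on D P = 1%E.

(* Z is a central subspace of the Banach space W, itself a closed subspace of
   X, so that the closed balls of W are the sets W `&` closed_ball y r. *)
Definition central_subspace W Z : Prop :=
  [/\ closed_subspace Z, Z `<=` W &
    forall (n : nat) (y : 'I_n -> X) (r : 'I_n -> R),
      (forall i, Z (y i)) -> (forall i, 0 < r i) ->
      W `&` \bigcap_i closed_ball (y i) (r i) !=set0 ->
      Z `&` \bigcap_i closed_ball (y i) (r i) !=set0].

(* Z1 `&` Y is locally constrained with respect to Z1 via Y. *)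
Definition locally_constrained Z1 Y : Prop :=
  forall z, Z1 z -> exists P Q,
    [/\ norm_one_projection (linear_span (z |` (Z1 `&` Y))) (Z1 `&` Y) P,
        norm_one_projection (linear_span (z |` Y)) Y Q &
        P z = Q z].

End Definitions.

(* Main.v *)
(* Centrality of Z1 moves a point of Y common to the balls to a point z of Z1
   common to them; the norm-one projection P of span {z, Z1 `&` Y} onto
   Z1 `&` Y fixes the centers, so P z still lies in all the balls. *)
Require Import Defs.
From mathcomp Require Import all_boot all_order all_algebra.
From mathcomp Require Import all_classical all_reals all_analysis.
Import numFieldNormedType.Exports.
Import Order.TTheory GRing.Theory Num.Theory.
Local Open Scope classical_set_scope.
Local Open Scope ring_scope.

Lemma linear_subspaceP (R : realType) (X : completeNormedModType R)
    (S : set X) :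
  linear_subspace S <->
  S 0 /\ forall (a : R) u v, S u -> S v -> S (a *: u + v).
Proof.
split=> [[S0 SZD]|[S0 SZD]]; split.
- by rewrite -inE.
- by move=> a u v Su Sv; rewrite -inE; apply: SZD; rewrite inE.
- by rewrite inE.
- by move=> a u v; rewrite !inE; exact: SZD.
Qed.

Lemma closed_subspaceI (R : realType) (X : completeNormedModType R)
    (S T : set X) :
  closed_subspace S -> closed_subspace T -> closed_subspace (S `&` T).
Proof.
move=> [/linear_subspaceP[S0 SZD] cS] [/linear_subspaceP[T0 TZD] cT].
split; last exact: closedI.
by apply/linear_subspaceP; split=> // a u v [Su Tu] [Sv Tv]; split;
  [exact: SZD|exact: TZD].
Qed.

Lemma linear_span_subspace (R : realType) (X : completeNormedModType R)
    (S : set X) : linear_subspace (linear_span S).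
Proof.
apply/linear_subspaceP; split.
  by move=> T [/linear_subspaceP[]].
move=> a u v Su Sv T [linT ST].
have [_] := (linear_subspaceP _ _ T).1 linT.
by apply; [exact: Su|exact: Sv].
Qed.

Lemma sub_linear_span (R : realType) (X : completeNormedModType R)
    (S : set X) : S `<=` linear_span S.
Proof. exact: sub_smallest. Qed.

(** [opnorm_on] only bounds [P] on the unit ball of [D]. A nonzero [x] is rescaled to norm one,
    which stays in [D], and homogeneity carries the bound back to [x]. *)
Lemma linear_on_contraction (R : realType) (X : completeNormedModType R)
    (D : set X) (P : X -> X) :
  linear_subspace D -> linear_on D P -> (opnorm_on D P <= 1)%E ->
  forall x, D x -> `|P x| <= `|x|.
Proof.
move=> /linear_subspaceP[D0 DZD] linP leP1 x Dx.
(* With scalar -1 and both vectors zero, linearity reads [P 0 = - P 0 + P 0]. *)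
have P0 : P 0 = 0.
  have := linP (-1) 0 0; rewrite !inE => /(_ D0 D0).
  by rewrite scaler0 addr0 scaleN1r addNr.
have [->|x0] := eqVneq x 0; first by rewrite P0.
have nx0 : 0 < `|x| by rewrite normr_gt0.
have Dnx : D (`|x|^-1 *: x) by rewrite -[_ *: _]addr0; exact: DZD.
have PZ : P (`|x|^-1 *: x) = `|x|^-1 *: P x.
  have := linP `|x|^-1 x 0; rewrite !inE => /(_ Dx D0).
  by rewrite !addr0 P0 addr0.
have : (`|P (`|x|^-1 *: x)|%:E <= 1)%E.
  apply: le_trans leP1; apply: ereal_sup_ubound; exists (`|x|^-1 *: x) => //.
  split=> //=.
  by rewrite normrZ ger0_norm ?invr_ge0// mulVf ?gt_eqF.
by rewrite lee_fin PZ normrZ ger0_norm ?invr_ge0// ler_pdivrMl// mulr1.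
Qed.

(** Since [P] fixes [y], linearity gives [y - P x = P (y - x)], and [P] does not increase norms on
    [D]. *)
Lemma norm_one_projection_dist_le (R : realType) (X : completeNormedModType R)
    (D Z : set X) (P : X -> X) :
  linear_subspace D -> norm_one_projection D Z P -> Z `<=` D ->
  forall x y, D x -> Z y -> `|y - P x| <= `|y - x|.
Proof.
move=> linD [[linP PDZ PP] P1] ZD x y Dx Zy.
(* [Z] is the image of [P], so [y = P u] for some [u] in [D], and idempotence applies. *)
have Py : P y = y.
  by move: Zy; rewrite -PDZ => -[u Du <-]; apply: PP; rewrite inE.
(* The difference [y - x] is put in the shape [a *: u + v], in which both closure of [D] and
   linearity of [P] are stated. *)
have Dyx : D (- 1 *: x + y).
  by have [_] := (linear_subspaceP _ _ D).1 linD; apply=> //; exact: ZD.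
have PB : P (- 1 *: x + y) = y - P x.
  by rewrite linP ?inE ?Py ?scaleN1r 1?addrC//; exact: ZD.
rewrite -PB [y - x]addrC -[- x]scaleN1r.
by apply: (linear_on_contraction _ _ _ _ linD linP) => //; rewrite P1.
Qed.

Theorem theorem2p1 (R : realType) (X : completeNormedModType R)
    (Z1 Y : set X) (hZ1 : closed_subspace Z1) (hY : closed_subspace Y)
    (hlc : locally_constrained Z1 Y) (hcentral : central_subspace setT Z1) :
  central_subspace Y (Z1 `&` Y).
Proof.
have [_ _ centralZ1] := hcentral.
split; [exact: closed_subspaceI|exact: subIsetr|].
move=> n y r Zy r0 [x [_ yx]].
have [z [Z1z yz]] : Z1 `&` \bigcap_i closed_ball (y i) (r i) !=set0.
  by apply: centralZ1 => // [i|]; [case: (Zy i)|exists x].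
have [P [_ [projP _ _]]] := hlc z Z1z.
set D := linear_span _ in projP.
have Dz : D z by apply: sub_linear_span; left.
have ZD : Z1 `&` Y `<=` D by move=> w Zw; apply: sub_linear_span; right.
exists (P z); split.
  by have [[_ <- _] _] := projP; exists z.
(* As [r i] is positive, membership in the ball is a norm inequality, and what remains is the chain
   [|y i - P z| <= |y i - z| <= r i]. *)
move=> i _; move: (yz i I); rewrite !closed_ballE// /closed_ball_ /=.
apply: le_trans.
by apply: (norm_one_projection_dist_le _ _ _ _ _ _ projP) => //;
  exact: linear_span_subspace.
Qed.
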